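(* Let $m,n\ge 0$ and $k=m+n+1$. Let $f\colon X\to Y$ be a large scale uniform function of metric spaces with coarseness control function $c_f$, and suppose $\operatorname{asdim}(Y)\le n$. If $f$ admits an $(m,k)$-dimensional control function $D_f$, then $\operatorname{asdim}(X)\le m+n$. Moreover, if $c_f$, some $n$-dimensional control function of $Y$, and $D_f$ can all be chosen linear (respectively, all dilations), then $X$ has a $(k-1)$-dimensional control function that is linear (respectively, a dilation).
   Context: For a metric space $X$ and $r>0$, an $r$-chain is a finite sequence $x_1,\dots,x_j$ with $d(x_i,x_{i+1})\le r$; the $r$-components of $A\subset X$ are the equivalence classes of points of $A$ under ''joined by an $r$-chain lying in $A$''. A set is $R$-bounded if its diameter is $\le R$. A family is $r$-disjoint if points in different members are at distance $\ge r$. An $n$-dimensional control function of $X$ is $D_X\colon\mathbb R_+\to\mathbb R_+$ such that for every $r>0$ there are $r$-disjoint families $\mathcal U_1,\dots,\mathcal U_{n+1}$ with members of diameter $\le D_X(r)$ whose union covers $X$; $\operatorname{asdim}(X)\le n$ iff such a function exists. $f\colon X\to Y$ is large scale uniform with coarseness control function $c_f\colon\mathbb R_+\to\mathbb R_+$ if $d_X(x,y)\le r\Rightarrow d_Y(f(x),f(y))\le c_f(r)$. Given $k\ge m+1\ge1$, an $(m,k)$-dimensional control function of $f$ is $D_f\colon\mathbb R_+\times\mathbb R_+\to\mathbb R_+$ such that for all $r_X,R_Y>0$ every $A\subset X$ with $\operatorname{diam} f(A)\le R_Y$ can be written as $A=A_1\cup\dots\cup A_k$ where the $r_X$-components of each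 $A_i$ are $D_f(r_X,R_Y)$-bounded and every $x\in A$ belongs to at least $k-m$ of the sets $A_i$. A one-variable function is linear if of the form $r\mapsto cr+b$ ($b,c\ge0$), a dilation if of the form $r\mapsto cr$ ($c>0$); a two-variable function is linear if of the form $(r,R)\mapsto ar+bR+c$ and a dilation if of the form $(r,R)\mapsto ar+bR$. *)

(* Defs.v *)
From Stdlib Require Import Reals List.
Import ListNotations.
Open Scope R_scope.

Record is_metric {X : Type} (d : X -> X -> R) : Prop := {
  metric_nonneg : forall x y, 0 <= d x y;
  metric_refl : forall x, d x x = 0;
  metric_sep : forall x y, d x y = 0 -> x = y;
  metric_sym : forall x y, d x y = d y x;
  metric_triangle : forall x y z, d x z <= d x y + d y z
}.

Fixpoint chain_in {X : Type} (d : X -> X -> R) (A : X -> Prop) (r : R)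
    (x : X) (l : list X) (y : X) : Prop :=
  match l with
  | [] => x = y
  | z :: l' => d x z <= r /\ A z /\ chain_in d A r z l' y
  end.

Definition r_connected {X : Type} (d : X -> X -> R) (A : X -> Prop) (r : R)
    (x y : X) : Prop :=
  A x /\ A y /\ exists l, chain_in d A r x l y.

Definition r_components_bounded {X : Type} (d : X -> X -> R) (A : X -> Prop)
    (r D : R) : Prop :=
  forall x y, r_connected d A r x y -> d x y <= D.

Definition bounded_by {X : Type} (d : X -> X -> R) (A : X -> Prop) (D : R) : Prop :=
  forall x y, A x -> A y -> d x y <= D.

Definition r_disjoint {X : Type} (d : X -> X -> R) (U : (X -> Prop) -> Prop) (r : R) : Prop :=
  forall A B, U A -> U B -> ~ (forall x, A x <-> B x) -> forall a b, A a -> B b -> r <= d a b.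

Definition dim_control_function {X : Type} (d : X -> X -> R) (n : nat) (D : R -> R) : Prop :=
  forall r, 0 < r ->
    exists U : nat -> (X -> Prop) -> Prop,
      (forall i, (i < n + 1)%nat ->
         r_disjoint d (U i) r /\ (forall A, U i A -> bounded_by d A (D r))) /\
      (forall x, exists i A, (i < n + 1)%nat /\ U i A /\ A x).

Definition asdim_le {X : Type} (d : X -> X -> R) (n : nat) : Prop :=
  exists D, dim_control_function d n D.

Definition large_scale_uniform {X Y : Type} (dX : X -> X -> R) (dY : Y -> Y -> R)
    (f : X -> Y) (c : R -> R) : Prop :=
  forall r x y, 0 < r -> dX x y <= r -> dY (f x) (f y) <= c r.

Definition mk_control_function {X Y : Type} (dX : X -> X -> R) (dY : Y -> Y -> R)
    (f : X -> Y) (m k : nat) (Df : R -> R -> R) : Prop :=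
  forall rX RY, 0 < rX -> 0 < RY ->
  forall A : X -> Prop,
    (forall a b, A a -> A b -> dY (f a) (f b) <= RY) ->
    exists As : nat -> X -> Prop,
      (forall x, A x <-> exists i, (i < k)%nat /\ As i x) /\
      (forall i, (i < k)%nat -> r_components_bounded dX (As i) rX (Df rX RY)) /\
      (forall x, A x -> exists S : list nat,
          NoDup S /\ (k - m <= length S)%nat /\
          forall i, In i S -> (i < k)%nat /\ As i x).

(* one-variable linear functions / dilations (on R_+, taken as r > 0) *)
Definition linear1 (g : R -> R) : Prop :=
  exists c b, 0 <= c /\ 0 <= b /\ forall r, 0 < r -> g r = c * r + b.
Definition dilation1 (g : R -> R) : Prop :=
  exists c, 0 < c /\ forall r, 0 < r -> g r = c * r.

Definition linear2 (g : R -> R -> R) : Prop :=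
  exists a b c, forall r R', 0 < r -> 0 < R' -> g r R' = a * r + b * R' + c.
Definition dilation2 (g : R -> R -> R) : Prop :=
  exists a b, forall r R', 0 < r -> 0 < R' -> g r R' = a * r + b * R'.

(* Main.v *)
Require Import Defs.
From Stdlib Require Import Reals List.
From Stdlib Require Import Lra Lia Classical IndefiniteDescription.
From Stdlib Require Import FunctionalExtensionality PropExtensionality.
Import ListNotations.
Open Scope R_scope.

(** Fix a scale [r].  Kolmogorov's trick turns the [n+1] families of [Y] into
    [k = m+n+1] sets [B i] whose [cf r]-components are [R]-bounded and such that
    every point of [Y] misses at most [n] of them.  A second cover of [Y], by
    [n+1] families [W j] of [R']-bounded sets, is taken [2R]-disjoint, so that a
    component of any [B i] meets at most one member of each [W j].  For [V] in
    [W j], decompose the preimage of [V] into [k] sets [A V i] at scale [s j];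
    every point misses at most [m] of them.  Since [m + n < k], the sets
    [E i], consisting of the points of [A V i] (over all [j] and [V]) that lie
    over [B i], cover [X].  An [r]-chain in [E i] stays over a
    single component of [B i], hence meets only one [A V i] for each [j], and
    these at most [n+1] sets can be merged one after the other when the scales
    [s j] grow fast enough.  As [R'] is fixed before the scales [s j], there is
    no circularity, and all bounds are iterated compositions of the data. *)

(** * Chain components *)

Lemma r_connected_refl {X : Type} (d : X -> X -> R) (A : X -> Prop) (r : R) (x : X) :
  A x -> r_connected d A r x x.
Proof. intros Hx; repeat split; auto; exists []; reflexivity. Qed.

Lemma r_connected_trans {X : Type} (d : X -> X -> R) (A : X -> Prop) (r : R) (x y z : X) :
  r_connected d A r x y -> r_connected d A r y z -> r_connected d A r x z.
Proof.
intros (Hx & _ & l & Hl) (_ & Hz & l' & Hl'); repeat split; auto.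
exists (l ++ l'); clear Hx; revert x Hl.
induction l as [|u l IH]; simpl; intros x Hl.
- now subst.
- destruct Hl as (Hd & Hu & Hl); auto.
Qed.

Lemma r_connected_snoc {X : Type} (d : X -> X -> R) (A : X -> Prop) (r : R) (x y z : X) :
  r_connected d A r x y -> A z -> d y z <= r -> r_connected d A r x z.
Proof.
intros Hxy Hz Hd; apply (r_connected_trans d A r x y z Hxy).
destruct Hxy as (_ & Hy & _); repeat split; auto.
exists [z]; simpl; auto.
Qed.

(** Induction along a chain; the step may also use that [u] is already joined to the starting
    point. *)
Lemma r_connected_invariant {X : Type} (d : X -> X -> R) (A : X -> Prop) (r : R)
    (x y : X) (P : X -> Prop) :
  P x ->
  (forall u v, r_connected d A r x u -> A v -> d u v <= r -> P u -> P v) ->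
  r_connected d A r x y -> P y.
Proof.
intros Px Hstep (Hx & Hy & l & Hl).
assert (G : forall l u, r_connected d A r x u -> P u ->
              chain_in d A r u l y -> P y).
{ clear l Hl; intros l; induction l as [|v l IH]; simpl; intros u Hu Pu Hl.
  - now subst.
  - destruct Hl as (Hd & Hv & Hl); apply (IH v); auto.
    + now apply (r_connected_snoc d A r x u v).
    + now apply (Hstep u v). }
apply (G l x); auto; now apply r_connected_refl.
Qed.

Lemma r_connected_sym {X : Type} (d : X -> X -> R) (hd : is_metric d)
    (A : X -> Prop) (r : R) (x y : X) :
  r_connected d A r x y -> r_connected d A r y x.
Proof.
intros Hxy; pose proof Hxy as (Hx & _).
apply (r_connected_invariant d A r x y (fun v => r_connected d A r v x)); auto.
- now apply r_connected_refl.
- intros u v Hu Hv Hd Hux.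
  apply (r_connected_trans d A r v u x); auto.
  apply (r_connected_snoc d A r v v u); [now apply r_connected_refl| |].
  + now destruct Hux.
  + now rewrite (metric_sym d hd).
Qed.

Lemma r_components_bounded_mono {X : Type} (d : X -> X -> R) (A A' : X -> Prop)
    (r D D' : R) :
  (forall x, A x -> A' x) -> D <= D' ->
  r_components_bounded d A' r D -> r_components_bounded d A r D'.
Proof.
intros HA HD HA' x y Hxy; apply Rle_trans with D; auto; apply HA'.
pose proof Hxy as (Hx & _).
apply (r_connected_invariant d A r x y (fun v => r_connected d A' r x v)); auto.
- apply r_connected_refl; auto.
- intros u v _ Hv Hd Hu; apply (r_connected_snoc d A' r x u v); auto.
Qed.

(** A chain that starts in [P] never leaves it, so it is a chain in the smaller set on which the
    bound is known. *)
Lemma r_components_bounded_invariant {X : Type} (d : X -> X -> R) (A P : X -> Prop)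
    (r D : R) (x y : X) :
  P x -> (forall u v, A u -> A v -> d u v <= r -> P u -> P v) ->
  r_components_bounded d (fun z => A z /\ P z) r D ->
  r_connected d A r x y -> d x y <= D.
Proof.
intros Px Hstep HD Hxy; apply HD; pose proof Hxy as (Hx & _).
apply (r_connected_invariant d A r x y
         (fun v => r_connected d (fun z => A z /\ P z) r x v)); auto.
- apply r_connected_refl; auto.
- intros u v _ Hv Hd Hu.
  apply (r_connected_snoc d _ r x u v); auto; split; auto.
  destruct Hu as (_ & (Au & Pu) & _); now apply (Hstep u v).
Qed.

(* A maximal run of a chain in [E] joins points of [F] at distance at most
   [D + 2 * r], so skipping these runs leaves a [(D + 2 * r)]-chain in [F]. *)
Lemma r_components_bounded_union {X : Type} (d : X -> X -> R) (hd : is_metric d)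
    (E F : X -> Prop) (r D D' : R) :
  0 < r -> 0 <= D -> 0 <= D' ->
  r_components_bounded d E r D -> r_components_bounded d F (D + 2 * r) D' ->
  r_components_bounded d (fun x => E x \/ F x) r (D' + 2 * (D + r)).
Proof.
intros Hr HD HD' HE HF x y Hxy.
set (s := D + 2 * r) in *.
(* Either the chain has stayed in [E], or [p] is an early point of [F] on it, [q] the latest one,
   and the tail after [q] runs in [E]. The two outer runs cost [D + r] each. *)
assert (HI : r_connected d E r x y \/
  exists p q, d x p <= D + r /\ r_connected d F s p q /\
    (q = y \/ exists e, d q e <= r /\ r_connected d E r e y)).
{ apply (r_connected_invariant d (fun x => E x \/ F x) r x y (fun v =>
    r_connected d E r x v \/
    exists p q, d x p <= D + r /\ r_connected d F s p q /\
      (q = v \/ exists e, d q e <= r /\ r_connected d E r e v))); auto.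
  - destruct Hxy as ([Hx | Hx] & _).
    + left; now apply r_connected_refl.
    + right; exists x, x; rewrite (metric_refl d hd); repeat split; auto.
      * lra.
      * exists []; reflexivity.
  - intros v w _ Hw Hd [Hv | (p & q & Hp & Hpq & Hq)]; destruct Hw as [Hw | Hw].
    + left; now apply (r_connected_snoc d E r x v w).
    + right; exists w, w; split; [|split; [now apply r_connected_refl | now left]].
      pose proof (HE x v Hv); pose proof (metric_triangle d hd x v w); lra.
    + right; exists p, q; split; [auto | split; [auto | right]].
      destruct Hq as [<- | (e & He & Hev)].
      * exists w; split; auto; now apply r_connected_refl.
      * exists e; split; auto; now apply (r_connected_snoc d E r e v w).
    + right; exists p, w; split; [auto | split; [| now left]].
      apply (r_connected_snoc d F s p q w); auto; unfold s.
      destruct Hq as [<- | (e & He & Hev)]; [lra|].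
      pose proof (HE e v Hev); pose proof (metric_triangle d hd q e w).
      pose proof (metric_triangle d hd e v w); lra. }
destruct HI as [H | (p & q & Hp & Hpq & Hq)].
- pose proof (HE x y H); lra.
- pose proof (HF p q Hpq); pose proof (metric_triangle d hd x p y).
  destruct Hq as [<- | (e & He & Hey)]; [lra|].
  pose proof (HE e y Hey); pose proof (metric_triangle d hd p q y).
  pose proof (metric_triangle d hd q e y); lra.
Qed.

(** * Disjoint families and sets with bounded components *)

(** As [s < r], a step of length at most [s] cannot pass between different members, so a chain stays
    in one. *)
Lemma r_disjoint_components_bounded {X : Type} (d : X -> X -> R)
    (U : (X -> Prop) -> Prop) (r s D : R) :
  s < r -> r_disjoint d U r -> (forall A, U A -> bounded_by d A D) ->
  r_components_bounded d (fun x => exists A, U A /\ A x) s D.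
Proof.
intros Hs HU HD x y Hxy.
pose proof Hxy as ((A & HA & Ax) & _).
apply (HD A HA); auto.
apply (r_connected_invariant d (fun x => exists A, U A /\ A x) s x y A); auto.
intros u v _ (B & HB & Bv) Hd Au.
apply NNPP; intros Av.
assert (r <= d u v); [|lra].
apply (HU A B); auto; intros Hext; apply Av, Hext, Bv.
Qed.

(** The members of the [i]-th family are the [r]-components of [E i]: points of [E i] closer than
    [r] share a component. *)
Lemma r_components_bounded_families {X : Type} (d : X -> X -> R) (hd : is_metric d)
    (n : nat) (E : nat -> X -> Prop) (r D : R) :
  (forall i, (i < n + 1)%nat -> r_components_bounded d (E i) r D) ->
  (forall x, exists i, (i < n + 1)%nat /\ E i x) ->
  exists U : nat -> (X -> Prop) -> Prop,
    (forall i, (i < n + 1)%nat ->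
       r_disjoint d (U i) r /\ (forall A, U i A -> bounded_by d A D)) /\
    (forall x, exists i A, (i < n + 1)%nat /\ U i A /\ A x).
Proof.
intros HE Hcov.
exists (fun i A => exists x, forall y, A y <-> r_connected d (E i) r x y).
split.
- intros i Hi; split.
  + intros A B (x & HA) (y & HB) Hneq a b Aa Bb.
    apply Rnot_lt_le; intros Hlt; apply Hneq; intros z.
    apply HA in Aa; apply HB in Bb.
    assert (Hxy : r_connected d (E i) r x y).
    { apply (r_connected_trans d _ r x b y).
      - apply (r_connected_snoc d _ r x a b); auto; [now destruct Bb as (_ & ? & _) | lra].
      - now apply r_connected_sym. }
    rewrite HA, HB; split; intros Hz.
    * apply (r_connected_trans d _ r y x z); auto; now apply r_connected_sym.
    * now apply (r_connected_trans d _ r x y z).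
  + intros A (x & HA) a b Aa Ab; apply HA in Aa, Ab; apply (HE i Hi).
    apply (r_connected_trans d _ r a x b); auto; now apply r_connected_sym.
- intros x; destruct (Hcov x) as (i & Hi & Hx).
  exists i, (r_connected d (E i) r x); repeat split; auto.
  + now exists x.
  + exists []; reflexivity.
Qed.

(** * Enlarging control functions *)

Lemma dim_control_function_le {X : Type} (d : X -> X -> R) (n : nat) (D D' : R -> R) :
  (forall r, 0 < r -> D r <= D' r) ->
  dim_control_function d n D -> dim_control_function d n D'.
Proof.
intros Hle HD r Hr; destruct (HD r Hr) as (U & HU & Hcov).
exists U; split; auto; intros i Hi; destruct (HU i Hi) as (Hdis & Hbd).
split; auto; intros A HA x y Ax Ay.
apply Rle_trans with (D r); auto; now apply (Hbd A).
Qed.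

Lemma large_scale_uniform_le {X Y : Type} (dX : X -> X -> R) (dY : Y -> Y -> R)
    (f : X -> Y) (c c' : R -> R) :
  (forall r, 0 < r -> c r <= c' r) ->
  large_scale_uniform dX dY f c -> large_scale_uniform dX dY f c'.
Proof. intros Hle Hc r x y Hr Hd; apply Rle_trans with (c r); auto. Qed.

Lemma mk_control_function_le {X Y : Type} (dX : X -> X -> R) (dY : Y -> Y -> R)
    (f : X -> Y) (m k : nat) (D D' : R -> R -> R) :
  (forall r s, 0 < r -> 0 < s -> D r s <= D' r s) ->
  mk_control_function dX dY f m k D -> mk_control_function dX dY f m k D'.
Proof.
intros Hle HD r s Hr Hs A HA.
destruct (HD r s Hr Hs A HA) as (As & Hcov & Hbd & Hmul).
exists As; split; [|split]; auto.
intros i Hi; apply (r_components_bounded_mono dX _ (As i) r (D r s)); auto.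
Qed.

(** * Kolmogorov's trick *)

Definition in_at_least {X : Type} (q k : nat) (B : nat -> X -> Prop) (x : X) : Prop :=
  exists S : list nat, NoDup S /\ (q <= length S)%nat /\
    forall i, In i S -> (i < k)%nat /\ B i x.

(** Pigeonhole: disjoint index lists would give [p + q] distinct indices below [k]. *)
Lemma in_at_least_meet {X : Type} (p q k : nat) (A B : nat -> X -> Prop) (x : X) :
  (k < p + q)%nat -> in_at_least p k A x -> in_at_least q k B x ->
  exists i, (i < k)%nat /\ A i x /\ B i x.
Proof.
intros Hk (S & HS & HpS & HA) (T & HT & HqT & HB).
apply NNPP; intros Hno.
assert (Hnd : NoDup (S ++ T)).
{ apply NoDup_app; auto; intros i HiS HiT; apply Hno; exists i.
  destruct (HA i HiS), (HB i HiT); auto. }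
assert (Hincl : incl (S ++ T) (seq 0 k)).
{ intros i Hi; apply in_seq; apply in_app_or in Hi.
  destruct Hi as [Hi | Hi]; [destruct (HA i Hi) | destruct (HB i Hi)]; lia. }
pose proof (NoDup_incl_length Hnd Hincl) as Hlen.
rewrite length_app, length_seq in Hlen; lia.
Qed.

(** The scale [2 * r] makes the separation strictly exceed a step. For each added set, steps of
    length [r] between thickened points become steps of length [3 * r] between their centres, and
    [2 * r] accounts for the two ends. *)
Fixpoint kolmogorov_bound (D : R -> R) (j : nat) (r : R) : R :=
  match j with
  | O => D (2 * r)
  | S j' => kolmogorov_bound D j' (3 * r) + 2 * r
  end.

(* Thicken each [B i] by [r] and add the set of points where thickening changes
   nothing: a short step inside the new set cannot leave any [B i]. *)
Lemma kolmogorov_cover {X : Type} (d : X -> X -> R) (hd : is_metric d) (n : nat)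
    (D : R -> R) (j : nat) :
  dim_control_function d n D ->
  forall r, 0 < r -> exists B : nat -> X -> Prop,
    (forall i, (i < n + 1 + j)%nat ->
       r_components_bounded d (B i) r (kolmogorov_bound D j r)) /\
    (forall x, in_at_least (j + 1) (n + 1 + j) B x).
Proof.
intros HD; induction j as [|j IH]; intros r Hr.
- destruct (HD (2 * r)) as (U & HU & Hcov); [lra|].
  exists (fun i x => exists A, U i A /\ A x); split.
  + intros i Hi; destruct (HU i) as (Hdis & Hbd); [lia|].
    apply (r_disjoint_components_bounded d (U i) (2 * r)); auto; lra.
  + intros x; destruct (Hcov x) as (i & A & Hi & HA & Ax).
    exists [i]; repeat split.
    * constructor; [simpl; tauto | constructor].
    * simpl; lia.
    * destruct H as [<- | []]; lia.
    * destruct H as [<- | []]; eauto.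
- destruct (IH (3 * r)) as (B & HB & Hmul); [lra|].
  set (k := (n + 1 + j)%nat) in *.
  set (T := fun i x => exists b, B i b /\ d x b <= r).
  set (N := fun x => forall i, (i < k)%nat -> T i x -> B i x).
  assert (BT : forall i x, B i x -> T i x).
  { intros i x Hx; exists x; split; auto; rewrite (metric_refl d hd); lra. }
  exists (fun i x => (i < k)%nat /\ T i x \/ i = k /\ N x); simpl; split.
  + intros i Hi; destruct (Nat.eq_dec i k) as [-> | Hik].
    * apply (r_components_bounded_mono d _ N r (kolmogorov_bound D j (3 * r)));
        [intros x [[H _] | [_ H]]; [lia | auto] | lra |].
      intros x y Hxy.
      (* Multiplicity [j + 1] puts [x] in some [B l]. A step in [N] from [B l] lands in [T l], hence
         in [B l] again. *)
      destruct (Hmul x) as ([|l S] & _ & Hlen & HS); [simpl in Hlen; lia|].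
      destruct (HS l) as (Hl & Bx); [now left|].
      apply (HB l Hl).
      apply (r_connected_invariant d N r x y (fun v => r_connected d (B l) (3 * r) x v)); auto.
      -- now apply r_connected_refl.
      -- intros u v _ Nv Hd Hu.
         apply (r_connected_snoc d (B l) (3 * r) x u v); auto; [|lra].
         apply Nv; auto; exists u; split; [now destruct Hu as (_ & ? & _)|].
         now rewrite (metric_sym d hd).
    * assert (Hi' : (i < k)%nat) by lia.
      apply (r_components_bounded_mono d _ (T i) r
               (kolmogorov_bound D j (3 * r) + 2 * r));
        [intros x [[_ H] | [H _]]; [auto | lia] | lra |].
      intros x y Hxy; pose proof Hxy as ((a & Ba & Ha) & _).
      (* The chain in [T i] is shadowed by a chain of centres in [B i]. *)
      assert (Hb : exists b, r_connected d (B i) (3 * r) a b /\ d y b <= r).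
      { apply (r_connected_invariant d (T i) r x y
          (fun v => exists b, r_connected d (B i) (3 * r) a b /\ d v b <= r)); auto.
        - exists a; split; auto; now apply r_connected_refl.
        - intros u v _ (c & Bc & Hc) Hd (b & Hab & Hb).
          exists c; split; auto.
          apply (r_connected_snoc d _ _ a b c); auto.
          pose proof (metric_triangle d hd b u c).
          pose proof (metric_triangle d hd u v c).
          rewrite (metric_sym d hd b u) in *; lra. }
      destruct Hb as (b & Hab & Hb).
      pose proof (HB i Hi' a b Hab).
      pose proof (metric_triangle d hd x a y).
      pose proof (metric_triangle d hd a b y).
      rewrite (metric_sym d hd b y) in *; lra.
  + intros x; destruct (Hmul x) as (S & HS & Hlen & HBS).
    (* One index is gained either way: [k] if [N x], otherwise some [i] with [x] in [T i] but not in
       [B i]. *)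
    destruct (classic (N x)) as [Nx | Nx].
    * exists (k :: S); split; [|split].
      -- constructor; auto; intros Hin; destruct (HBS k Hin); lia.
      -- simpl; lia.
      -- intros i [<- | Hi]; [split; [lia | now right]|].
         destruct (HBS i Hi); split; [lia | left; auto].
    * apply not_all_ex_not in Nx; destruct Nx as (i & Nx).
      apply imply_to_and in Nx; destruct Nx as (Hi & Nx).
      apply imply_to_and in Nx; destruct Nx as (Tx & Bx).
      exists (i :: S); split; [|split].
      -- constructor; auto; intros Hin; destruct (HBS i Hin); auto.
      -- simpl; lia.
      -- intros l [<- | Hl]; [split; [lia | now left]|].
         destruct (HBS l Hl); split; [lia | left; auto].
Qed.

(** * The combined bound *)

(* [merge_bound D r j] bounds the [r]-components of the union of the first
   [j + 1] sets when the set of index [i] has [merge_scale D r i]-components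
   bounded by [D (merge_scale D r i)]. *)
Fixpoint merge_bound (D : R -> R) (r : R) (j : nat) : R :=
  match j with
  | O => D r
  | S j' => D (merge_bound D r j' + 2 * r) + 2 * (merge_bound D r j' + r)
  end.

(** The scale that [r_components_bounded_union] demands of the next set to be merged. *)
Definition merge_scale (D : R -> R) (r : R) (j : nat) : R :=
  match j with
  | O => r
  | S j' => merge_bound D r j' + 2 * r
  end.

Lemma merge_bound_nonneg (D : R -> R) (r : R) (j : nat) :
  0 < r -> (forall s, 0 < s -> 0 <= D s) -> 0 <= merge_bound D r j.
Proof.
intros Hr HD; induction j as [|j IH]; simpl; [now apply HD|].
assert (0 <= D (merge_bound D r j + 2 * r)) by (apply HD; lra); lra.
Qed.

Lemma merge_scale_pos (D : R -> R) (r : R) (j : nat) :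
  0 < r -> (forall s, 0 < s -> 0 <= D s) -> 0 < merge_scale D r j.
Proof.
intros Hr HD; destruct j as [|j]; simpl; auto.
pose proof (merge_bound_nonneg D r j Hr HD); lra.
Qed.

Lemma r_components_bounded_merge {X : Type} (d : X -> X -> R) (hd : is_metric d)
    (D : R -> R) (r : R) (E : nat -> X -> Prop) (n : nat) :
  0 < r -> (forall s, 0 < s -> 0 <= D s) ->
  (forall j, (j <= n)%nat ->
     r_components_bounded d (E j) (merge_scale D r j) (D (merge_scale D r j))) ->
  r_components_bounded d (fun x => exists j, (j <= n)%nat /\ E j x) r (merge_bound D r n).
Proof.
intros Hr HD; induction n as [|n IH]; intros HE.
- apply (r_components_bounded_mono d _ (E 0%nat) r (D r)); [|simpl; lra|].
  + intros x (j & Hj & Hx); now replace 0%nat with j by lia.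
  + now apply (HE 0%nat).
- apply (r_components_bounded_mono d _
    (fun x => (exists j, (j <= n)%nat /\ E j x) \/ E (S n) x) r (merge_bound D r (S n))).
  + intros x (j & Hj & Hx); destruct (Nat.eq_dec j (S n)) as [-> | Hjn]; auto.
    left; exists j; split; [lia | auto].
  + lra.
  + simpl; apply r_components_bounded_union; auto.
    * now apply merge_bound_nonneg.
    * apply HD; pose proof (merge_bound_nonneg D r n Hr HD); lra.
Qed.

(** The Kolmogorov bound at scale [c r] is the [R] of the overview, and [DY] of twice that bound is
    [R']. *)
Definition hurewicz_bound (m n : nat) (c DY : R -> R) (Df : R -> R -> R) (r : R) : R :=
  merge_bound (fun s => Df s (DY (2 * kolmogorov_bound DY m (c r)))) r n.

(** * The dimension estimate for the domain *)

Lemma kolmogorov_bound_pos (D : R -> R) (j : nat) :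
  (forall r, 0 < r -> 0 < D r) -> forall r, 0 < r -> 0 < kolmogorov_bound D j r.
Proof.
intros HD; induction j as [|j IH]; simpl; intros r Hr.
- apply HD; lra.
- assert (0 < kolmogorov_bound D j (3 * r)) by (apply IH; lra); lra.
Qed.

Theorem hurewicz_dim_control (m n : nat) (X Y : Type)
    (dX : X -> X -> R) (dY : Y -> Y -> R) (hX : is_metric dX) (hY : is_metric dY)
    (f : X -> Y) (c DY : R -> R) (Df : R -> R -> R) :
  (forall r, 0 < r -> 0 < c r) -> (forall r, 0 < r -> 0 < DY r) ->
  (forall r s, 0 < r -> 0 < s -> 0 <= Df r s) ->
  large_scale_uniform dX dY f c ->
  dim_control_function dY n DY ->
  mk_control_function dX dY f m (m + n + 1) Df ->
  dim_control_function dX (m + n) (hurewicz_bound m n c DY Df).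
Proof.
intros Hc0 HDY0 HDf0 Hc HDY HDf r Hr; unfold hurewicz_bound.
set (rho := kolmogorov_bound DY m (c r)).
assert (Hrho : 0 < rho) by (apply kolmogorov_bound_pos; auto).
set (rho' := DY (2 * rho)).
assert (Hrho' : 0 < rho') by (apply HDY0; lra).
set (D := fun s => Df s rho').
assert (HD : forall s, 0 < s -> 0 <= D s) by (intros s Hs; now apply HDf0).
destruct (kolmogorov_cover dY hY n DY m HDY (c r) (Hc0 r Hr)) as (B & HB & HBmul).
replace (n + 1 + m)%nat with (m + n + 1)%nat in * by lia.
destruct (HDY (2 * rho)) as (W & HW & HWcov); [lra|]; fold rho' in HW.
set (k := (m + n + 1)%nat) in *.
assert (HA : exists A : nat * (Y -> Prop) -> nat -> X -> Prop,
  forall jV, (fst jV < n + 1)%nat -> W (fst jV) (snd jV) ->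
    (forall i x, (i < k)%nat -> A jV i x -> snd jV (f x)) /\
    (forall i, (i < k)%nat ->
       r_components_bounded dX (A jV i) (merge_scale D r (fst jV))
         (D (merge_scale D r (fst jV)))) /\
    (forall x, snd jV (f x) -> in_at_least (n + 1) k (A jV) x)).
{ apply (functional_choice (A := (nat * (Y -> Prop))%type)
    (fun jV A => (fst jV < n + 1)%nat -> W (fst jV) (snd jV) ->
    (forall i x, (i < k)%nat -> A i x -> snd jV (f x)) /\
    (forall i, (i < k)%nat ->
       r_components_bounded dX (A i) (merge_scale D r (fst jV))
         (D (merge_scale D r (fst jV)))) /\
    (forall x, snd jV (f x) -> in_at_least (n + 1) k A x))).
  intros [j V]; simpl.
  (* Pairs outside the cover receive empty sets as a default. *)
  destruct (classic ((j < n + 1)%nat /\ W j V)) as [[Hj HV] | Hno];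
    [| exists (fun _ _ => False); tauto].
  destruct (HDf (merge_scale D r j) rho' (merge_scale_pos D r j Hr HD) Hrho'
              (fun x => V (f x))) as (A & HAV & HAbd & HAmul).
  { intros a b; now apply (proj2 (HW j Hj) V HV). }
  exists A; intros _ _; split; [|split]; auto.
  - intros i x Hi Hx; apply HAV; now exists i.
  - intros x Hx; destruct (HAmul x Hx) as (S & HS & Hlen & HAS).
    exists S; split; [|split]; auto; unfold k in Hlen; lia. }
destruct HA as (A & HA).
set (G := fun i j x => exists V, (j < n + 1)%nat /\ W j V /\ A (j, V) i x).
apply (r_components_bounded_families dX hX (m + n)
         (fun i x => B i (f x) /\ exists j, G i j x)).
- fold k; intros i Hi x y Hxy.
  (* An [r]-chain maps to a [c r]-chain in [B i], so it stays over the component [C] of [f x]. *)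
  set (C := r_connected dY (B i) (c r) (f x)).
  pose proof Hxy as ((Bx & _) & _).
  apply (r_components_bounded_invariant dX
           (fun x => B i (f x) /\ exists j, G i j x) (fun z => C (f z)) r _ x y); auto.
  { now apply r_connected_refl. }
  { intros u v _ (Bv & _) Hd Hu; apply (r_connected_snoc dY _ _ _ (f u)); auto. }
  apply (r_components_bounded_mono dX _
    (fun x => exists j, (j <= n)%nat /\ (G i j x /\ C (f x))) r (merge_bound D r n));
    [| lra |].
  { intros z ((_ & j & Hj) & Cz); exists j; split; auto.
    destruct Hj as (V & Hj & _); lia. }
  apply r_components_bounded_merge; auto.
  intros j Hj u v Huv; pose proof Huv as (((V & Hj' & HV & Hu) & Cu) & _).
  destruct (HA (j, V) Hj' HV) as (HAV & HAbd & _); simpl in HAV, HAbd.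
  revert Huv; apply (r_components_bounded_mono dX _ (A (j, V) i)
    (merge_scale D r j) (D (merge_scale D r j))); [| lra | auto].
  intros w ((V' & _ & HV' & Hw) & Cw).
  (* Both members of [W j] meet [C], whose diameter is at most [rho], while different members are
     [2 * rho] apart. *)
  assert (HVV : V = V').
  { apply NNPP; intros Hne.
    assert (Hfar : 2 * rho <= dY (f u) (f w)).
    { apply (proj1 (HW j Hj') V V'); auto.
      - intros Hext; apply Hne; extensionality z; now apply propositional_extensionality.
      - now apply (HAV i).
      - now apply (proj1 (HA (j, V') Hj' HV') i). }
    assert (Hnear : dY (f u) (f w) <= rho); [|lra].
    apply (HB i Hi); apply (r_connected_trans dY _ _ _ (f x)); auto.
    now apply r_connected_sym. }
  now rewrite HVV.
- fold k; intros x; destruct (HWcov (f x)) as (j & V & Hj & HV & Hx).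
  destruct (HA (j, V) Hj HV) as (_ & _ & HAmul).
  (* The multiplicities [n + 1] and [m + 1] add up to [k + 1]. *)
  destruct (in_at_least_meet (n + 1) (m + 1) k (A (j, V)) (fun i x => B i (f x)) x)
    as (i & Hi & HAi & HBi); auto.
  + unfold k; lia.
  + apply (HBmul (f x)).
  + exists i; split; auto; split; auto; exists j, V; auto.
Qed.

(** * Linear functions and dilations *)

(* [z = False] gives the linear functions with positive slope, [z = True] the
   dilations. *)
Definition affine1 (z : Prop) (g : R -> R) : Prop :=
  exists a b, 0 < a /\ 0 <= b /\ (z -> b = 0) /\ forall r, 0 < r -> g r = a * r + b.

Definition affine2 (z : Prop) (g : R -> R -> R) : Prop :=
  exists a b e, 0 <= a /\ 0 <= b /\ 0 <= e /\ (z -> e = 0) /\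
    forall r s, 0 < r -> 0 < s -> g r s = a * r + b * s + e.

Lemma affine1_pos (z : Prop) (g : R -> R) (r : R) : affine1 z g -> 0 < r -> 0 < g r.
Proof.
intros (a & b & Ha & Hb & _ & Hg) Hr; rewrite Hg by auto.
pose proof (Rmult_lt_0_compat a r Ha Hr); lra.
Qed.

Lemma affine2_nonneg (z : Prop) (g : R -> R -> R) (r s : R) :
  affine2 z g -> 0 < r -> 0 < s -> 0 <= g r s.
Proof.
intros (a & b & e & Ha & Hb & He & _ & Hg) Hr Hs; rewrite Hg by auto.
pose proof (Rmult_le_pos a r Ha (Rlt_le _ _ Hr)).
pose proof (Rmult_le_pos b s Hb (Rlt_le _ _ Hs)); lra.
Qed.

Lemma affine1_scale (z : Prop) (a : R) : 0 < a -> affine1 z (fun r => a * r).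
Proof. intros Ha; exists a, 0; repeat split; auto; intros; lra. Qed.

Lemma affine1_plus (z : Prop) (g h : R -> R) :
  affine1 z g -> affine1 z h -> affine1 z (fun r => g r + h r).
Proof.
intros (a & b & Ha & Hb & Hz & Hg) (a' & b' & Ha' & Hb' & Hz' & Hh).
exists (a + a'), (b + b'); split; [lra | split; [lra | split]].
- intros z0; rewrite Hz, Hz' by auto; lra.
- intros r Hr; rewrite Hg, Hh by auto; lra.
Qed.

Lemma affine1_comp (z : Prop) (g h : R -> R) :
  affine1 z g -> affine1 z h -> affine1 z (fun r => g (h r)).
Proof.
intros (a & b & Ha & Hb & Hz & Hg) Hh.
pose proof (fun r => affine1_pos z h r Hh) as Hpos.
destruct Hh as (a' & b' & Ha' & Hb' & Hz' & Hh).
exists (a * a'), (a * b' + b); split; [nra | split; [nra | split]].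
- intros z0; rewrite Hz, Hz' by auto; lra.
- intros r Hr; rewrite Hg by auto; rewrite Hh by auto; lra.
Qed.

(* The extra summand [h r] keeps the slope positive. *)
Lemma affine2_comp_plus (z : Prop) (g : R -> R -> R) (h1 h2 h : R -> R) :
  affine2 z g -> affine1 z h1 -> affine1 z h2 -> affine1 z h ->
  affine1 z (fun r => g (h1 r) (h2 r) + h r).
Proof.
intros (a & b & e & Ha & Hb & He & Hz & Hg) H1 H2 Hh.
pose proof (fun r => affine1_pos z h1 r H1) as Hp1.
pose proof (fun r => affine1_pos z h2 r H2) as Hp2.
destruct H1 as (a1 & b1 & Ha1 & Hb1 & Hz1 & H1).
destruct H2 as (a2 & b2 & Ha2 & Hb2 & Hz2 & H2).
destruct Hh as (a3 & b3 & Ha3 & Hb3 & Hz3 & Hh).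
exists (a * a1 + b * a2 + a3), (a * b1 + b * b2 + e + b3).
split; [nra | split; [nra | split]].
- intros z0; rewrite Hz, Hz1, Hz2, Hz3 by auto; lra.
- intros r Hr; rewrite Hg by auto; rewrite H1, H2, Hh by auto; lra.
Qed.

Lemma affine1_kolmogorov_bound (z : Prop) (D : R -> R) (j : nat) :
  affine1 z D -> affine1 z (kolmogorov_bound D j).
Proof.
intros HD; induction j as [|j IH]; simpl.
- apply (affine1_comp z D (fun r => 2 * r)); auto; apply affine1_scale; lra.
- apply affine1_plus; [|apply affine1_scale; lra].
  apply (affine1_comp z (kolmogorov_bound D j) (fun r => 3 * r)); auto.
  apply affine1_scale; lra.
Qed.

(** The summand [r] ensures a positive slope even when [g] vanishes. *)
Lemma affine1_merge_bound (z : Prop) (g : R -> R -> R) (h : R -> R) (j : nat) :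
  affine2 z g -> affine1 z h ->
  affine1 z (fun r => merge_bound (fun s => g s (h r)) r j + r).
Proof.
intros Hg Hh; assert (Hid : affine1 z (fun r => r)).
{ exists 1, 0; repeat split; intros; lra. }
induction j as [|j IH]; simpl.
- now apply (affine2_comp_plus z g (fun r => r) h (fun r => r)).
- set (M := fun r => merge_bound (fun s => g s (h r)) r j + r) in *.
  (* This is the recursion of [merge_bound] rewritten in terms of [M]. *)
  assert (H : affine1 z (fun r => g (M r + r) (h r) + (2 * M r + r))).
  { apply (affine2_comp_plus z g (fun r => M r + r) h (fun r => 2 * M r + r)); auto.
    - now apply affine1_plus.
    - apply affine1_plus; auto.
      apply (affine1_comp z (fun r => 2 * r) M); auto; apply affine1_scale; lra. }
  destruct H as (a & b & Ha & Hb & Hz & H); exists a, b; repeat split; auto.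
  intros r Hr; rewrite <- H by auto; unfold M.
  replace (merge_bound (fun s => g s (h r)) r j + r + r)
    with (merge_bound (fun s => g s (h r)) r j + 2 * r) by ring; ring.
Qed.

Lemma affine_dim_control (z : Prop) (m n : nat) (X Y : Type)
    (dX : X -> X -> R) (dY : Y -> Y -> R) (hX : is_metric dX) (hY : is_metric dY)
    (f : X -> Y) (c DY : R -> R) (Df : R -> R -> R) :
  affine1 z c -> affine1 z DY -> affine2 z Df ->
  large_scale_uniform dX dY f c ->
  dim_control_function dY n DY ->
  mk_control_function dX dY f m (m + n + 1) Df ->
  exists DX, affine1 z DX /\ dim_control_function dX (m + n) DX.
Proof.
intros Hc HDY HDf Hcf HdY Hmk.
exists (fun r => hurewicz_bound m n c DY Df r + r); split.
- apply (affine1_merge_bound z Df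
           (fun r => DY (2 * kolmogorov_bound DY m (c r)))); auto.
  apply (affine1_comp z DY (fun r => 2 * kolmogorov_bound DY m (c r))); auto.
  apply (affine1_comp z (fun r => 2 * r) (fun r => kolmogorov_bound DY m (c r))).
  + apply affine1_scale; lra.
  + apply (affine1_comp z (kolmogorov_bound DY m) c); auto.
    now apply affine1_kolmogorov_bound.
- apply (dim_control_function_le dX (m + n) (hurewicz_bound m n c DY Df));
    [intros; lra|].
  apply (hurewicz_dim_control m n X Y dX dY hX hY f); auto.
  + intros r; now apply (affine1_pos z).
  + intros r; now apply (affine1_pos z).
  + intros r s; now apply (affine2_nonneg z).
Qed.

(** A linear function may have slope zero; raising the slope by one makes it positive and only
    enlarges the values. *)
Lemma linear1_le_affine1 (g : R -> R) :
  linear1 g -> exists h, affine1 False h /\ forall r, 0 < r -> g r <= h r.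
Proof.
intros (c & b & Hc & Hb & Hg); exists (fun r => (c + 1) * r + b); split.
- exists (c + 1), b; repeat split; auto; [lra | tauto].
- intros r Hr; rewrite Hg by auto; lra.
Qed.

Lemma affine1_linear1 (g : R -> R) : affine1 False g -> linear1 g.
Proof. intros (a & b & Ha & Hb & _ & Hg); exists a, b; repeat split; auto; lra. Qed.

Lemma dilation1_iff_affine1 (g : R -> R) : dilation1 g <-> affine1 True g.
Proof.
split.
- intros (c & Hc & Hg); exists c, 0; repeat split; auto; [lra|].
  intros r Hr; rewrite Hg by auto; lra.
- intros (a & b & Ha & _ & Hb & Hg); exists a; split; auto.
  intros r Hr; rewrite Hg, Hb by auto; lra.
Qed.

(** Coefficients of two-variable functions carry no sign condition, so absolute values replace
    them. *)
Lemma affine2_majorant (z : Prop) (g : R -> R -> R) (a b e : R) :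
  (z -> e = 0) ->
  (forall r s, 0 < r -> 0 < s -> g r s = a * r + b * s + e) ->
  exists h, affine2 z h /\ forall r s, 0 < r -> 0 < s -> g r s <= h r s.
Proof.
intros Hz Hg; exists (fun r s => Rabs a * r + Rabs b * s + Rabs e); split.
- exists (Rabs a), (Rabs b), (Rabs e); repeat split; auto using Rabs_pos.
  intros z0; rewrite Hz by auto; apply Rabs_R0.
- intros r s Hr Hs; rewrite Hg by auto.
  pose proof (Rmult_le_compat_r r _ _ (Rlt_le _ _ Hr) (Rle_abs a)).
  pose proof (Rmult_le_compat_r s _ _ (Rlt_le _ _ Hs) (Rle_abs b)).
  pose proof (Rle_abs e); lra.
Qed.

Theorem mainTheorem2 (m n : nat) (X Y : Type)
    (dX : X -> X -> R) (dY : Y -> Y -> R)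
    (hX : is_metric dX) (hY : is_metric dY)
    (f : X -> Y) (cf : R -> R) (Df : R -> R -> R) :
  large_scale_uniform dX dY f cf ->
  asdim_le dY n ->
  mk_control_function dX dY f m (m + n + 1) Df ->
  asdim_le dX (m + n) /\
  ((exists c, linear1 c /\ large_scale_uniform dX dY f c) ->
   (exists DY, linear1 DY /\ dim_control_function dY n DY) ->
   (exists D, linear2 D /\ mk_control_function dX dY f m (m + n + 1) D) ->
   exists DX, linear1 DX /\ dim_control_function dX (m + n + 1 - 1) DX) /\
  ((exists c, dilation1 c /\ large_scale_uniform dX dY f c) ->
   (exists DY, dilation1 DY /\ dim_control_function dY n DY) ->
   (exists D, dilation2 D /\ mk_control_function dX dY f m (m + n + 1) D) ->
   exists DX, dilation1 DX /\ dim_control_function dX (m + n + 1 - 1) DX).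
Proof.
intros Hcf (DY & HDY) HDf.
replace (m + n + 1 - 1)%nat with (m + n)%nat by lia.
split; [|split].
(* Absolute values and the added [1] supply the positivity that the estimate assumes. *)
- exists (hurewicz_bound m n (fun r => Rabs (cf r) + 1) (fun r => Rabs (DY r) + 1)
            (fun r s => Rabs (Df r s))).
  apply (hurewicz_dim_control m n X Y dX dY hX hY f).
  + intros r _; pose proof (Rabs_pos (cf r)); lra.
  + intros r _; pose proof (Rabs_pos (DY r)); lra.
  + intros r s _ _; apply Rabs_pos.
  + apply (large_scale_uniform_le dX dY f cf); auto.
    intros r _; pose proof (Rle_abs (cf r)); lra.
  + apply (dim_control_function_le dY n DY); auto.
    intros r _; pose proof (Rle_abs (DY r)); lra.
  + apply (mk_control_function_le dX dY f m _ Df); auto.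
    intros r s _ _; apply Rle_abs.
- intros (c & Hc & Hlc) (D & HD & HlD) (g & (a & b & e & Hg) & Hlg).
  destruct (linear1_le_affine1 c Hc) as (c' & Hc' & Hcc).
  destruct (linear1_le_affine1 D HD) as (D' & HD' & HDD).
  destruct (affine2_majorant False g a b e) as (g' & Hg' & Hgg); [tauto | auto |].
  destruct (affine_dim_control False m n X Y dX dY hX hY f c' D' g')
    as (DX & HDX & HdX); auto.
  + now apply (large_scale_uniform_le dX dY f c).
  + now apply (dim_control_function_le dY n D).
  + now apply (mk_control_function_le dX dY f m _ g).
  + exists DX; split; auto; now apply affine1_linear1.
- intros (c & Hc & Hlc) (D & HD & HlD) (g & (a & b & Hg) & Hlg).
  apply dilation1_iff_affine1 in Hc, HD.
  destruct (affine2_majorant True g a b 0) as (g' & Hg' & Hgg);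
    [auto | intros r s Hr Hs; rewrite Hg by auto; lra |].
  destruct (affine_dim_control True m n X Y dX dY hX hY f c D g')
    as (DX & HDX & HdX); auto.
  + now apply (mk_control_function_le dX dY f m _ g).
  + exists DX; split; auto; now apply dilation1_iff_affine1.
Qed.
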